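(* Let $\mathcal{K}_0\subseteq\mathbb{R}^{n_1}$, $\mathcal{K}_i\subseteq\mathbb{R}^{n_2}$, $i\in[1:S]$, be closed convex cones, and let $A\in\mathcal{S}^{n_1}$, $a\in\mathbb{R}^{n_1}$, $B_i\in\mathbb{R}^{n_1\times n_2}$, $C_i\in\mathcal{S}^{n_2}$, $c_i\in\mathbb{R}^{n_2}$, $F_i\in\mathbb{R}^{m_i\times n_1}$, $G_i\in\mathbb{R}^{m_i\times n_2}$, $r_i\in\mathbb{R}^{m_i}$ for $i\in[1:S]$, and let $\hat Q_j$, $j\in[1:K]$, be real-valued affine-linear functions of $(x,X,y_1,Z_1,Y_1,\dots,y_S,Z_S,Y_S)$. For variables $x\in\mathbb{R}^{n_1}$, $X\in\mathcal{S}^{n_1}$, $y_i\in\mathbb{R}^{n_2}$, $Z_i\in\mathbb{R}^{n_2\times n_1}$, $Y_i\in\mathcal{S}^{n_2}$, consider the objective function $$\operatorname{tr}(AX)+a^{\mathsf T}x+\sum_{i=1}^S\left[\operatorname{tr}(B_iZ_i)+\operatorname{tr}(C_iY_i)+c_i^{\mathsf T}y_i\right]$$ and the linear constraints $$\text{(L)}\quad F_ix+G_iy_i=r_i,\quad \operatorname{diag}\left(\begin{pmatrix}F_i&G_i\end{pmatrix}\begin{pmatrix}X&Z_i^{\mathsf T}\\ Z_i&Y_i\end{pmatrix}\begin{pmatrix}F_i^{\mathsf T}\\ G_i^{\mathsf T}\end{pmatrix}\right)=r_i\circ r_i\quad (i\in[1:S]),$$ $$\hat Q_j(x,X,y_1,Z_1,Y_1,\dots,y_S,Z_S,Y_S)=0\quad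 (j\in[1:K]).$$ Let $\mathrm{val}(SDP)$ be the optimal value of minimizing the objective subject to (L) and the constraint that, with additional variables $Y_{i,j}\in\mathbb{R}^{n_2\times n_2}$ ($i\ne j$) and $Y_{i,i}=Y_i$, $$\begin{pmatrix}1&x^{\mathsf T}&y_1^{\mathsf T}&\cdots&y_S^{\mathsf T}\\ x&X&Z_1^{\mathsf T}&\cdots&Z_S^{\mathsf T}\\ y_1&Z_1&Y_{1,1}&\cdots&Y_{1,S}\\ \vdots&\vdots&\vdots&\ddots&\vdots\\ y_S&Z_S&Y_{S,1}&\cdots&Y_{S,S}\end{pmatrix}\in\mathcal{S}_+^{n_1+Sn_2+1}.$$ Let $\mathrm{val}(R)$ be the optimal value of minimizing the objective subject to (L) and $$\begin{pmatrix}1&x^{\mathsf T}&y_i^{\mathsf T}\\ x&X&Z_i^{\mathsf T}\\ y_i&Z_i&Y_i\end{pmatrix}\in\mathcal{CPP}(\mathbb{R}_+\times\mathcal{K}_0\times\mathcal{K}_i),\quad i\in[1:S].$$ Then $\mathrm{val}(SDP)\le\mathrm{val}(R)$. The statement also holds if, in the definition of $\mathrm{val}(R)$, the cones $\mathcal{CPP}(\mathbb{R}_+\times\mathcal{K}_0\times\mathcal{K}_i)$, $i\in[1:S]$, are replaced by any other subsets of $\mathcal{S}_+^{n_1+n_2+1}$.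
   Context: Notation: $[1:S]=\{1,\dots,S\}$; $\mathcal{S}^m$ is the space of real symmetric $m\times m$ matrices and $\mathcal{S}^m_+$ the cone of positive semidefinite ones; $\circ$ is the elementwise product of vectors; $\operatorname{diag}(M)$ is the vector of diagonal entries of $M$. For a closed convex cone $\mathcal{K}\subseteq\mathbb{R}^m$ the set-completely positive cone is $\mathcal{CPP}(\mathcal{K}):=\{\sum_{l=1}^{p}x_lx_l^{\mathsf T} : x_l\in\mathcal{K},\ p\in\mathbb{N}\}$. Optimal values are infima in $[-\infty,+\infty]$, with value $+\infty$ for infeasible problems. (In the application the $\hat Q_j$ are linearizations of quadratic functions $Q_j(x,y_1,\dots,y_S)$ having no bilinear terms between $y_i$ and $y_l$ for $i\ne l$, i.e. $\hat Q_j(x,xx^{\mathsf T},y_1,y_1x^{\mathsf T},y_1y_1^{\mathsf T},\dots,y_S,y_Sx^{\mathsf T},y_Sy_S^{\mathsf T})=Q_j(x,y_1,\dots,y_S)$.) *)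

(* Defs.v *)
From HB Require Import structures.
From mathcomp Require Import all_boot all_order all_algebra sesquilinear.
From mathcomp Require Import all_classical all_reals all_analysis.
Set Implicit Arguments.
Unset Strict Implicit.
Unset Printing Implicit Defensive.
Import Order.TTheory GRing.Theory Num.Theory.
Import numFieldNormedType.Exports.
Local Open Scope classical_set_scope.
Local Open Scope ring_scope.

Definition closed_convex_cone (R : realType) (n : nat) (K : set 'cV[R]_n) :
    Prop :=
  [/\ closed K, K !=set0,
      @convex_set R (convex_lmodType 'cV[R]_n) K
    & forall (t : R) (v : 'cV[R]_n), 0 <= t -> K v -> K (t *: v)].

Definition psd_cone (R : realType) (n : nat) : set 'M[R]_n :=
  [set M | M \is symmetricmx
         /\ forall u : 'cV[R]_n, 0 <= (u^T *m M *m u) 0 0].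

(* The sum may be empty (p = 0), in which case it is the zero matrix; when K
   contains 0 this makes no difference. *)
Definition cpp (R : realType) (n : nat) (K : set 'cV[R]_n) : set 'M[R]_n :=
  [set M | exists (p : nat) (v : 'I_p -> 'cV[R]_n),
      (forall l, K (v l)) /\ M = \sum_(l < p) v l *m (v l)^T].

(* The cone R_+ x K0 x K1, with triples stacked into one column. *)
Definition ray_prod (R : realType) (n1 n2 : nat)
    (K0 : set 'cV[R]_n1) (K1 : set 'cV[R]_n2) : set 'cV[R]_(1 + (n1 + n2)) :=
  [set v | exists (t : R) (x : 'cV[R]_n1) (y : 'cV[R]_n2),
      [/\ 0 <= t, K0 x, K1 y & v = col_mx t%:M (col_mx x y)]].

Definition diag_vec (R : realType) (n : nat) (M : 'M[R]_n) : 'cV[R]_n :=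
  \col_k M k k.

Definition hadamard (R : realType) (n : nat) (u v : 'cV[R]_n) : 'cV[R]_n :=
  map2_mx *%R u v.

(* Values (x, X, (y_i, Z_i, Y_i)_i) of the decision variables.  The type is a
   full vector space: symmetry of X and of the Y_i is the separate predicate
   [sym_vars]. *)
Definition vars (R : realType) (S n1 n2 : nat) : lmodType R :=
  ('cV[R]_n1 * 'M[R]_n1 *
     {ffun 'I_S -> 'cV[R]_n2 * 'M[R]_(n2, n1) * 'M[R]_n2})%type.

Section Problem.
Variables (R : realType) (S n1 n2 : nat).
Implicit Types (v : vars R S n1 n2) (i j : 'I_S).

Definition var_x v : 'cV[R]_n1 := v.1.1.
Definition var_X v : 'M[R]_n1 := v.1.2.
Definition var_y v i : 'cV[R]_n2 := (v.2 i).1.1.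
Definition var_Z v i : 'M[R]_(n2, n1) := (v.2 i).1.2.
Definition var_Y v i : 'M[R]_n2 := (v.2 i).2.

Definition sym_vars : set (vars R S n1 n2) :=
  [set v | var_X v \is symmetricmx /\ forall i, var_Y v i \is symmetricmx].

(* q is affine-linear as a function of the variables with X and the Y_i
   symmetric; its values elsewhere are irrelevant. *)
Definition affine_linear (q : vars R S n1 n2 -> R) : Prop :=
  exists (l : {linear vars R S n1 n2 -> R^o}) (b : R),
    forall v, sym_vars v -> q v = l v + b.

Definition objective (A : 'M[R]_n1) (a : 'cV[R]_n1)
    (B : 'I_S -> 'M[R]_(n1, n2)) (C : 'I_S -> 'M[R]_n2) (c : 'I_S -> 'cV[R]_n2)
    v : R :=
  \tr (A *m var_X v) + (a^T *m var_x v) 0 0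
  + \sum_(i < S) (\tr (B i *m var_Z v i) + \tr (C i *m var_Y v i)
                  + ((c i)^T *m var_y v i) 0 0).

(* The constraints (L), together with the symmetry of X and of the Y_i. *)
Definition lin_feasible (K : nat) (m : 'I_S -> nat)
    (F : forall i, 'M[R]_(m i, n1)) (G : forall i, 'M[R]_(m i, n2))
    (r : forall i, 'cV[R]_(m i)) (Q : 'I_K -> vars R S n1 n2 -> R) :
    set (vars R S n1 n2) :=
  [set v | [/\ sym_vars v,
      forall i, F i *m var_x v + G i *m var_y v i = r i,
      forall i,
        diag_vec (row_mx (F i) (G i)
                  *m block_mx (var_X v) (var_Z v i)^T (var_Z v i) (var_Y v i)
                  *m col_mx (F i)^T (G i)^T)
        = hadamard (r i) (r i)
    & forall j : 'I_K, Q j v = 0]].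

Definition local_mx v i : 'M[R]_(1 + (n1 + n2)) :=
  block_mx 1%:M (row_mx (var_x v)^T (var_y v i)^T)
           (col_mx (var_x v) (var_y v i))
           (block_mx (var_X v) (var_Z v i)^T (var_Z v i) (var_Y v i)).

(* W i j is the block Y_{i,j}; the matrix has order
   1 + (n1 + \sum_(i < S) n2) = n1 + S n2 + 1. *)
Definition global_mx v (W : 'I_S -> 'I_S -> 'M[R]_n2) :
    'M[R]_(1 + (n1 + \sum_(i < S) n2)) :=
  block_mx 1%:M (row_mx (var_x v)^T (\mxrow_(i < S) (var_y v i)^T))
           (col_mx (var_x v) (\mxcol_(i < S) var_y v i))
           (block_mx (var_X v) (\mxrow_(i < S) (var_Z v i)^T)
                     (\mxcol_(i < S) var_Z v i)
                     (\mxblock_(i < S, j < S) W i j)).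

Definition sdp_feasible : set (vars R S n1 n2) :=
  [set v | exists W : 'I_S -> 'I_S -> 'M[R]_n2,
      (forall i, W i i = var_Y v i) /\ psd_cone (global_mx v W)].

Definition local_feasible (T : 'I_S -> set 'M[R]_(1 + (n1 + n2))) :
    set (vars R S n1 n2) :=
  [set v | forall i, T i (local_mx v i)].

Definition opt_val (f : vars R S n1 n2 -> R) (D : set (vars R S n1 n2)) :
    \bar R :=
  ereal_inf [set (f v)%:E | v in D].

End Problem.

(* Main.v *)
Require Import Defs.
From HB Require Import structures.
From mathcomp Require Import all_boot all_order all_algebra sesquilinear.
From mathcomp Require Import all_classical all_reals all_analysis.
From mathcomp Require Import ring lra.
Set Implicit Arguments.
Unset Strict Implicit.
Unset Printing Implicit Defensive.
Import Order.TTheory GRing.Theory Num.Theory.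
Import numFieldNormedType.Exports.
Local Open Scope classical_set_scope.
Local Open Scope ring_scope.

(* Proof idea: the feasible set of R is contained in that of SDP.  Let M be the
   common leading block [1, x^T; x, X] of the local matrices and let N_i be the
   row block [y_i, Z_i].  Positive semidefiniteness forces ker M to annihilate
   N_i, so N_i = D_i M for some D_i, and the generalized Schur complement
   Y_i - D_i M D_i^T is positive semidefinite.  Put Y_{i,j} = D_i M D_j^T for
   i <> j: then, D being the column of the D_i, the generalized Schur complement
   of M in the global matrix is the block diagonal matrix of the local ones. *)

Section QuadraticForm.
Variable R : realType.

Lemma symmetricmx_trP n (M : 'M[R]_n) : reflect (M^T = M) (M \is symmetricmx).
Proof.
rewrite is_hermitianmxE expr0 scale1r map_mx_id //.
by apply: (iffP eqP) => [/esym|/esym].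
Qed.

Lemma mx11D (A B : 'M[R]_1) : (A + B) 0 0 = A 0 0 + B 0 0.
Proof. by rewrite mxE. Qed.

Definition qform n (M : 'M[R]_n) (u : 'cV[R]_n) : R := (u^T *m M *m u) 0 0.

Lemma qform_outer n (x u : 'cV[R]_n) :
  qform (x *m x^T) u = (x^T *m u) 0 0 ^+ 2.
Proof.
rewrite /qform mulmxA -mulmxA.
have -> : u^T *m x = (x^T *m u)^T by rewrite trmx_mul trmxK.
by rewrite mxE big_ord1 mxE expr2.
Qed.

Lemma qform_mxdiag S n (M : 'I_S -> 'M[R]_n) (u : 'I_S -> 'cV[R]_n) :
  qform (\mxdiag_i M i) (\mxcol_i u i) = \sum_i qform (M i) (u i).
Proof.
rewrite /qform -mulmxA mul_mxdiag_mxcol tr_mxcol mul_mxrow_mxcol summxE.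
by apply: eq_bigr => i _; rewrite mulmxA.
Qed.

Lemma psd_mxdiag S n (M : 'I_S -> 'M[R]_n) :
  (forall i, psd_cone (M i)) -> psd_cone (\mxdiag_i M i).
Proof.
move=> Mpsd; split.
  apply/symmetricmx_trP; rewrite tr_mxdiag; congr mxdiag; apply/funext => i.
  by apply/symmetricmx_trP; case: (Mpsd i).
move=> u; rewrite -(submxcolK u) -/(qform _ _) qform_mxdiag.
by apply: sumr_ge0 => i _; case: (Mpsd i) => _; apply.
Qed.

Lemma cpp_sub_psd_cone n (K : set 'cV[R]_n) : cpp K `<=` @psd_cone R n.
Proof.
move=> M [p [v [_ ->]]]; split.
  apply/symmetricmx_trP; rewrite raddf_sum; apply: eq_bigr => l _ /=.
  by rewrite trmx_mul trmxK.
move=> u; rewrite mulmx_sumr mulmx_suml summxE.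
by apply: sumr_ge0 => l _; rewrite -/(qform _ _) qform_outer sqr_ge0.
Qed.

End QuadraticForm.

Section Bordered.
Variables (R : realType) (k n q : nat).
Variables (E : 'M[R]_k) (x : 'M[R]_(n, k)) (y : 'M[R]_(q, k)).
Variables (X : 'M[R]_n) (Z : 'M[R]_(q, n)) (Y : 'M[R]_q).

(* [local_mx] and [global_mx] are both of this shape; up to reassociation of the
   blocks it is [M, N^T; N, Y] for the matrices M and N below. *)
Definition bordered_mx : 'M[R]_(k + (n + q)) :=
  block_mx E (row_mx x^T y^T) (col_mx x y) (block_mx X Z^T Z Y).

Local Notation M := (block_mx E x^T x X).
Local Notation N := (row_mx y Z).

Lemma qform_bordered (t : 'cV[R]_k) (p : 'cV[R]_n) (w : 'cV[R]_q) :
  qform bordered_mx (col_mx t (col_mx p w)) =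
  qform M (col_mx t p) + (w^T *m N *m col_mx t p) 0 0 *+ 2 + qform Y w.
Proof.
have -> : (w^T *m N *m col_mx t p) 0 0 *+ 2 =
    (w^T *m N *m col_mx t p + (col_mx t p)^T *m N^T *m w) 0 0.
  rewrite mulr2n mx11D; congr (_ + _).
  by rewrite -[in RHS](trmxK w) -!trmx_mul mulmxA [RHS]mxE.
rewrite /qform /bordered_mx !tr_col_mx tr_row_mx.
rewrite !(mul_row_block, mul_mx_row, mul_row_col, add_row_mx) !mulmxDl.
rewrite !mx11D; ring.
Qed.

Lemma qform_bordered_schur (D : 'M[R]_(q, k + n)) (t : 'cV[R]_k)
    (p : 'cV[R]_n) (w : 'cV[R]_q) :
  M^T = M -> N = D *m M ->
  qform bordered_mx (col_mx t (col_mx p w)) =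
  qform M (col_mx t p + D^T *m w) + qform (Y - D *m M *m D^T) w.
Proof.
move=> Msym ND; rewrite qform_bordered ND.
move: (M) (col_mx t p) Msym => P h Psym.
have cross : (w^T *m (D *m P) *m h) 0 0 = (h^T *m P *m D^T *m w) 0 0.
  rewrite -[in RHS](trmxK w) -[in RHS]Psym -!trmx_mul [RHS]mxE.
  by rewrite !mulmxA.
have expand : qform P (h + D^T *m w) =
    qform P h + (w^T *m (D *m P) *m h) 0 0 *+ 2 + qform (D *m P *m D^T) w.
  rewrite mulr2n {2}cross /qform [(_ + _)^T]raddfD /= trmx_mul trmxK.
  rewrite !(mulmxDl, mulmxDr) !mx11D !mulmxA; ring.
have split_form (A B : 'M[R]_q) : qform (A - B) w = qform A w - qform B w.
  by rewrite /qform mulmxBr mulmxBl !mxE.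
rewrite expand split_form; ring.
Qed.

Lemma psd_bordered_head : psd_cone bordered_mx -> X^T = X -> E^T = E ->
  psd_cone M.
Proof.
move=> [_ Bge0] Xs Es; split.
  by apply/symmetricmx_trP; rewrite tr_block_mx trmxK Xs Es.
move=> h; have := Bge0 (col_mx (usubmx h) (col_mx (dsubmx h) 0)).
rewrite -/(qform _ _) qform_bordered vsubmxK trmx0 !mul0mx /qform.
by rewrite trmx0 !mul0mx [(0 : 'M[R]_1) _ _]mxE mul0rn !addr0.
Qed.

(* A linear function bounded below is constant: applied to the form at
   (s h, w) with M h = 0, this gives w^T N h = 0. *)
Lemma psd_bordered_range : psd_cone bordered_mx -> (N <= M)%MS.
Proof.
move=> [_ Bge0]; rewrite submxE; apply/eqP/matrixP => i j.
pose h := col j (cokermx M); pose w : 'cV[R]_q := delta_mx i 0.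
have Mh : M *m h = 0 by rewrite /h colE mulmxA mulmx_coker mul0mx.
have entry (P : 'M[R]_(k + n)) : (N *m P) i j = (w^T *m N *m col j P) 0 0.
  rewrite /w trmx_delta colE !mulmxA -(mulmxA (delta_mx 0 i)) -rowE -colE.
  by rewrite [RHS]mxE [RHS]mxE.
rewrite entry [RHS]mxE -/h; set a := (_ *m h) 0 0.
have line s : 0 <= s * a *+ 2 + qform Y w.
  have := Bge0 (col_mx (usubmx (s *: h)) (col_mx (dsubmx (s *: h)) w)).
  rewrite -/(qform _ _) qform_bordered vsubmxK /(qform M) -!mulmxA -scalemxAr.
  rewrite Mh scaler0 mulmx0 [(0 : 'M[R]_1) _ _]mxE add0r.
  by rewrite -!scalemxAr [X in X *+ 2]mxE mulmxA.
apply/eqP/negP => /negP a_neq0.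
have := line (- (qform Y w + 1) / a); rewrite divfK //.
have := line 0; rewrite mul0r mul0rn add0r; lra.
Qed.

Lemma psd_bordered_schur (D : 'M[R]_(q, k + n)) :
  psd_cone bordered_mx -> M^T = M -> Y^T = Y -> N = D *m M ->
  psd_cone (Y - D *m M *m D^T).
Proof.
move=> [_ Bge0] Ms Ys ND; split.
  apply/symmetricmx_trP.
  by rewrite [(_ - _)^T]raddfB /= !trmx_mul trmxK Ms Ys mulmxA.
move=> w; pose h := - (D^T *m w).
have := Bge0 (col_mx (usubmx h) (col_mx (dsubmx h) w)).
rewrite -/(qform _ _) (qform_bordered_schur _ _ _ Ms ND) vsubmxK addNr.
by rewrite {1}/qform trmx0 !mul0mx [(0 : 'M[R]_1) _ _]mxE add0r.
Qed.

Lemma schur_psd_bordered (D : 'M[R]_(q, k + n)) :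
  psd_cone M -> N = D *m M -> psd_cone (Y - D *m M *m D^T) ->
  X^T = X -> E^T = E -> psd_cone bordered_mx.
Proof.
move=> [/symmetricmx_trP Ms Mge0] ND [/symmetricmx_trP Ss Sge0] Xs Es; split.
  have Ys : Y^T = Y.
    rewrite -(subrK (D *m M *m D^T) Y) [(_ + _)^T]raddfD /= Ss.
    by rewrite !trmx_mul trmxK Ms mulmxA.
  apply/symmetricmx_trP; rewrite /bordered_mx tr_block_mx tr_row_mx tr_col_mx.
  by rewrite tr_block_mx !trmxK Xs Ys Es.
move=> u; rewrite -(vsubmxK u) -(vsubmxK (dsubmx u)) -/(qform _ _).
by rewrite (qform_bordered_schur _ _ _ Ms ND) addr_ge0 ?Mge0 ?Sge0.
Qed.

End Bordered.

Lemma local_psd_sdp_feasible (R : realType) (S n1 n2 : nat)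
    (v : vars R S n1 n2) :
  (0 < S)%N -> sym_vars v -> (forall i, psd_cone (local_mx v i)) ->
  sdp_feasible v.
Proof.
move=> S_gt0 [/symmetricmx_trP Xs Ys] Lpsd.
have tr1 : (1%:M : 'M[R]_1)^T = 1%:M by rewrite trmx1.
pose M := block_mx 1%:M (var_x v)^T (var_x v) (var_X v).
pose N i := row_mx (var_y v i) (var_Z v i).
have Mpsd : psd_cone M.
  exact: (psd_bordered_head (Lpsd (Ordinal S_gt0)) Xs tr1).
have Ms : M^T = M by apply/symmetricmx_trP; case: Mpsd.
have /choice [D ND] : forall i, exists Di, N i = Di *m M.
  by move=> i; apply/submxP; exact: (psd_bordered_range (Lpsd i)).
have schur i : psd_cone (var_Y v i - D i *m M *m (D i)^T).
  apply: (psd_bordered_schur (Lpsd i) Ms _ (ND i)).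
  exact/symmetricmx_trP.
exists (fun i j => if i == j then var_Y v i else D i *m M *m (D j)^T).
split=> [i|]; first by rewrite eqxx.
have -> : global_mx v (fun i j => if i == j then var_Y v i
                                  else D i *m M *m (D j)^T) =
    bordered_mx 1%:M (var_x v) (\mxcol_i var_y v i) (var_X v)
      (\mxcol_i var_Z v i)
      (\mxblock_(i, j) (if i == j then var_Y v i else D i *m M *m (D j)^T)).
  by rewrite /global_mx /bordered_mx !tr_mxcol.
apply: (@schur_psd_bordered _ _ _ _ _ _ _ _ _ _ (\mxcol_i D i)) => //.
  transitivity (\mxcol_i N i).
    by apply/matrixP => i j; rewrite !mxE; case: (fintype.split j) => ?; rewrite !mxE.
  by rewrite mxcol_mul; apply: eq_mxcol => i; exact: ND.
rewrite mxcol_mul tr_mxcol mul_mxcol_mxrow -mxblockB.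
rewrite (_ : mxblock _ = \mxdiag_i (var_Y v i - D i *m M *m (D i)^T)).
  exact: psd_mxdiag.
apply: eq_mxblock => i j; case: eqVneq => [<-|]; last by rewrite subrr.
by rewrite conform_mx_id.
Qed.

Theorem theorem5 (R : realType) (S K n1 n2 : nat) (m : 'I_S -> nat)
    (S_gt0 : (0 < S)%N)
    (K0 : set 'cV[R]_n1) (Ki : 'I_S -> set 'cV[R]_n2)
    (K0_cone : closed_convex_cone K0)
    (Ki_cone : forall i, closed_convex_cone (Ki i))
    (A : 'M[R]_n1) (a : 'cV[R]_n1)
    (B : 'I_S -> 'M[R]_(n1, n2)) (C : 'I_S -> 'M[R]_n2) (c : 'I_S -> 'cV[R]_n2)
    (A_sym : A \is symmetricmx) (C_sym : forall i, C i \is symmetricmx)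
    (F : forall i, 'M[R]_(m i, n1)) (G : forall i, 'M[R]_(m i, n2))
    (r : forall i, 'cV[R]_(m i))
    (Q : 'I_K -> vars R S n1 n2 -> R)
    (Q_affine : forall j, affine_linear (Q j)) :
  let f := objective A a B C c in
  let L := lin_feasible F G r Q in
  let val_sdp := opt_val f (L `&` @sdp_feasible R S n1 n2) in
  let val_R (T : 'I_S -> set 'M[R]_(1 + (n1 + n2))) :=
    opt_val f (L `&` local_feasible T) in
  (val_sdp <= val_R (fun i => cpp (ray_prod K0 (Ki i))))%E
  /\ forall T : 'I_S -> set 'M[R]_(1 + (n1 + n2)),
       (forall i, T i `<=` @psd_cone R (1 + (n1 + n2))) ->
       (val_sdp <= val_R T)%E.
Proof.
move=> f L val_sdp val_R.
have main T : (forall i, T i `<=` @psd_cone R (1 + (n1 + n2))) ->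
    (val_sdp <= val_R T)%E.
  move=> Tpsd; apply/ereal_inf_le_tmp/image_subset => v [Lv Tv]; split => //.
  apply: local_psd_sdp_feasible => // [|i]; last exact: Tpsd.
  by case: Lv.
by split; [apply: main => i; exact: cpp_sub_psd_cone | exact: main].
Qed.
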